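(* Let $a,b\ge 3$ and $k\ge 2$ be integers and let $G=CB(k,a,b)$ be the cycle barbell. Then \begin{align*} \mathscr{K}_v(G)=\frac{1}{a+b+k-1}\Bigg[&\frac{(a+1)(a-1)}{6}\bigl(a+2(b+k-1)\bigr)+\frac{(b+1)(b-1)}{6}\bigl(b+2(a+k-1)\bigr)\\ &+(a+b)(k-1)^2+\frac{(k-1)(2k^2-4k+3)}{6}+2ab(k-1)\Bigg]. \end{align*}
   Context: The cycle barbell $CB(k,a,b)$ is the graph obtained from a cycle $C_a$, a path $P_k$ on $k$ vertices and a cycle $C_b$ by identifying one endpoint of the path with a vertex of $C_a$ and the other endpoint with a vertex of $C_b$. It has $a+b+k-2$ vertices and $a+b+k-1$ edges. The vertex Kemeny's constant $\mathscr{K}_v(G)$ is Kemeny's constant of the simple random walk on the vertices of $G$ (transition matrix $D^{-1}A$): if this matrix has eigenvalues $1=\rho_1,\rho_2,\dots,\rho_n$, then $\mathscr{K}_v(G)=\sum_{i=2}^n\frac{1}{1-\rho_i}$; equivalently $\sum_{j\ne i}\pi_j m_{ij}$ with $\pi$ the stationary distribution and $m_{ij}$ mean first passage times. *)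

(* Defs.v *)
From HB Require Import structures.
From mathcomp Require Import all_boot all_order all_algebra all_field.
Set Implicit Arguments. Unset Strict Implicit. Unset Printing Implicit Defensive.
Import Order.TTheory GRing.Theory Num.Theory.
Local Open Scope ring_scope.

(* Cycle barbell CB(k,a,b) on vertex set 'I_(a+b+k-2), labelled as follows:
   - C_a : vertices 0,1,...,a-1 with edges i~i+1 (i < a-1) and 0~(a-1);
   - P_k : vertices a-1, a, ..., a+k-2 (its endpoint a-1 is identified with
           a vertex of C_a) with edges i~i+1;
   - C_b : vertices a+k-2, ..., a+b+k-3 (its vertex a+k-2 is identified with
           the other endpoint of P_k) with edges i~i+1 and (a+k-2)~(a+b+k-3).
   Altogether: the consecutive edges i~i+1 (0 <= i < n-1) plus the two
   "closing" edges {0, a-1} and {a+k-2, n-1}, with n = a+b+k-2. *)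
Definition cb_n (k a b : nat) : nat := (a + b + k - 2)%N.

Definition cb_edge (k a b : nat) (i j : nat) : bool :=
  let n := cb_n k a b in
  [|| (j == i.+1) && (j < n)%N, (i == j.+1) && (i < n)%N,
      [&& i == 0%N, j == a.-1 & (j < n)%N], [&& j == 0%N, i == a.-1 & (i < n)%N],
      [&& i == (a + k - 2)%N, j == n.-1 & (i < j)%N]
    | [&& j == (a + k - 2)%N, i == n.-1 & (j < i)%N]].

Definition cb_adj (k a b : nat) : rel 'I_(cb_n k a b) :=
  fun i j => cb_edge k a b i j.

Definition cb_deg (k a b : nat) (i : 'I_(cb_n k a b)) : nat :=
  #|[set j | @cb_adj k a b i j]|.

Definition cb_trans (k a b : nat) : 'M[algC]_(cb_n k a b) :=
  \matrix_(i, j) ((@cb_adj k a b i j)%:R / (@cb_deg k a b i)%:R).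

Definition eigenvalues (n : nat) (M : 'M[algC]_n) : seq algC :=
  sval (closed_field_poly_normal (char_poly M)).

Definition kemeny (n : nat) (P : 'M[algC]_n) : algC :=
  \sum_(r <- rem 1 (eigenvalues P)) (1 - r)^-1.

Definition vertex_kemeny_cb (k a b : nat) : algC := kemeny (cb_trans k a b).

(* Main.v *)
Require Import Defs.
From HB Require Import structures.
From mathcomp Require Import all_boot all_order all_algebra all_field.
From mathcomp Require Import perm ring zify.
Set Implicit Arguments.
Unset Strict Implicit.
Unset Printing Implicit Defensive.
Import Order.TTheory GRing.Theory Num.Theory.
Local Open Scope ring_scope.

(* Kemeny's constant is the logarithmic derivative at [1] of [char_poly P]
   divided by ['X - 1].  If [G] inverts [1 - P] up to the projection [u *m w] on
   constants, that quotient is, up to a scalar, [\det (1 + ('X - 1) G)], so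
   Jacobi's formula gives [\tr G].  For a walk on a network it follows that
   Kemeny's constant is [\tr (G C)], where [G] is now any Green function of the
   Laplacian and [C] is [cov_mx] of the degrees.
   The barbell is the path [0 - 1 - ... - (n-1)] with two extra edges.  The path
   grounded at [0] has Green function [min(i, j)].  By Sherman-Morrison each
   extra edge subtracts [p^T p / r], with [p] the potential of a unit current
   between its ends and [r] the length of the cycle that it closes. *)

Lemma deriv_prod (R : comNzRingType) (I : finType) (F : I -> {poly R}) :
  (\prod_i F i)^`() = \sum_i (F i)^`() * \prod_(j | j != i) F j.
Proof.
suff deriv_uniq s : uniq s -> (\prod_(i <- s) F i)^`() =
    \sum_(i <- s) (F i)^`() * \prod_(j <- s | j != i) F j.
  exact/deriv_uniq/index_enum_uniq.
elim: s => [|i s IHs] /=; first by rewrite !big_nil derivC.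
case/andP=> s'i /IHs derivE.
rewrite !big_cons derivM derivE eqxx; congr (_ * _ + _).
  rewrite big_seq [RHS]big_seq_cond; apply: eq_bigl => j.
  by case sj: (j \in s); rewrite // (memPn s'i).
rewrite mulr_sumr; apply: eq_big_seq => j sj.
by rewrite big_cons eq_sym (memPn s'i) // mulrCA.
Qed.

Lemma deriv_det (R : comNzRingType) (n : nat) (A : 'M[{poly R}]_n) :
  (\det A)^`() = \tr (\adj A *m map_mx (fun p => p^`()) A).
Proof.
have -> : \tr (\adj A *m map_mx (fun p => p^`()) A) =
    \sum_i \sum_j (A i j)^`() * cofactor A i j.
  rewrite exchange_big; apply: eq_bigr => j _; rewrite mxE.
  by apply: eq_bigr => i _; rewrite !mxE mulrC.
have deriv_term (s : 'S_n) : ((-1) ^+ s * \prod_i A i (s i))^`() =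
    \sum_i (A i (s i))^`() * ((-1) ^+ s * \prod_(k | i != k) A k (s k)).
  rewrite mulr_sign (fun_if deriv) derivN -mulr_sign deriv_prod mulr_sumr.
  apply: eq_bigr => i _; rewrite mulrCA; congr (_ * (_ * _)).
  by apply: eq_bigl => k; rewrite eq_sym.
rewrite /determinant raddf_sum /=; under eq_bigr do rewrite deriv_term.
rewrite exchange_big; apply: eq_bigr => i _.
rewrite (partition_big (fun s : 'S_n => s i) xpredT) //=.
apply: eq_bigr => j _; rewrite expand_cofactor mulr_sumr.
by apply: eq_bigr => s /eqP <-.
Qed.

Lemma deriv_det_scalar1D (R : comNzRingType) (n : nat) (A : 'M[R]_n) (x : R)
    (f := \det (1%:M + ('X - x%:P) *: map_mx polyC A)) :
  (f.[x] = 1) * (f^`().[x] = \tr A).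
Proof.
have at_x :
    map_mx (horner_eval x) (1%:M + ('X - x%:P) *: map_mx polyC A) = 1%:M.
  rewrite map_mxD map_mx1 map_mxZ /= /horner_eval !hornerE subrr scale0r.
  exact: addr0.
split; first by rewrite -[LHS]/(horner_eval x f) -det_map_mx at_x det1.
rewrite -[LHS]/(horner_eval x f^`()) deriv_det -trace_map_mx map_mxM map_mx_adj.
rewrite at_x adj1 mul1mx; congr (\tr _); apply/matrixP => i j.
rewrite !mxE derivD derivMn derivM derivXsubC !derivC mul0rn.
by rewrite mul1r mulr0 addr0 add0r; exact: hornerC.
Qed.

Lemma det_1DmulC (R : comNzRingType) (m n : nat)
    (u : 'M[R]_(m, n)) (v : 'M[R]_(n, m)) :
  \det (1%:M + u *m v) = \det (1%:M + v *m u).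
Proof.
have <- : \det (block_mx 1%:M u (- v) 1%:M) = \det (1%:M + u *m v).
  have <- : block_mx (1%:M + u *m v) u 0 1%:M *m block_mx 1%:M 0 (- v) 1%:M
          = block_mx 1%:M u (- v) 1%:M.
    by rewrite mulmx_block !mulmx1 !mul1mx !mul0mx !mulmx0 !mulmxN addrK !add0r.
  by rewrite det_mulmx det_ublock det_lblock !det1 !mulr1.
have <- : block_mx 1%:M 0 (- v) 1%:M *m block_mx 1%:M u 0 (1%:M + v *m u)
        = block_mx 1%:M u (- v) 1%:M.
  rewrite mulmx_block !mulmx1 !mul1mx !mul0mx !addr0 mulNmx.
  by rewrite addrCA addNr addr0.
by rewrite det_mulmx det_ublock det_lblock !det1 !mul1r.
Qed.

Lemma log_deriv_prod_XsubC (F : fieldType) (s : seq F) (x : F)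
    (q := \prod_(r <- s) ('X - r%:P)) :
  q.[x] != 0 -> q^`().[x] / q.[x] = \sum_(r <- s) (x - r)^-1.
Proof.
rewrite {}/q; elim: s => [|r s IHs].
  by rewrite !big_nil derivC horner0 mul0r.
rewrite !big_cons derivM derivXsubC mul1r !hornerE mulf_eq0 => /norP[xr0 qx0].
by rewrite -IHs //; field; rewrite qx0 xr0.
Qed.

Lemma kemeny_log_deriv (n : nat) (P : 'M[algC]_n) (q : {poly algC}) :
  char_poly P = ('X - 1%:P) * q -> q.[1] != 0 -> kemeny P = q^`().[1] / q.[1].
Proof.
rewrite /kemeny /eigenvalues.
case: closed_field_poly_normal => s /= charE charP q1.
rewrite (monicP (char_poly_monic P)) scale1r in charE.
have s1 : 1 \in s.
  by rewrite -root_prod_XsubC -charE charP /root hornerM !hornerE subrr mul0r.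
rewrite charP (perm_big _ (perm_to_rem s1)) big_cons /= in charE.
have /mulfI/(_ _ _ charE) qE : 'X - 1%:P != 0 :> {poly algC}.
  by rewrite polyXsubC_eq0.
by rewrite qE in q1 *; rewrite log_deriv_prod_XsubC.
Qed.

(* [(y + A) (G + u w) = (1 + y G) (1 + (y - 1) u w)]. *)
Lemma det_scalarD_group_inverse (R : comNzRingType) (n : nat) (A G : 'M[R]_n)
    (u : 'cV[R]_n) (w : 'rV[R]_n) (y : R) :
    A *m u = 0 -> G *m u = 0 -> w *m u = 1%:M -> A *m G = 1%:M - u *m w ->
  \det (y%:M + A) * \det (G + u *m w) = y * \det (1%:M + y *: G).
Proof.
move=> Au Gu wu AG.
have det_y : \det (1%:M + u *m ((y - 1) *: w)) = y.
  by rewrite det_1DmulC -scalemxAl wu scalemx1 -raddfD det_scalar1 addrC subrK.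
rewrite -[X in _ = X * _]det_y [RHS]mulrC -!det_mulmx; congr (\det _).
rewrite mulmxDl !mulmxDr AG [A *m _]mulmxA Au mul0mx addr0.
rewrite !mul_scalar_mx mulmx1.
rewrite mulmxDl mul1mx -scalemxAl mulmxA -!scalemxAr Gu mul0mx !scaler0 addr0.
by rewrite scalerBl scale1r addrC addrACA [- _ + _]addrC.
Qed.

Section GroupInverse.

Variables (n : nat) (P : 'M[algC]_n) (u : 'cV[algC]_n) (w : 'rV[algC]_n).
Hypotheses (Pu : P *m u = u) (wu : w *m u = 1%:M).

Lemma char_poly_group_inverse (G : 'M[algC]_n) (y : {poly algC} := 'X - 1%:P) :
    G *m u = 0 -> (1%:M - P) *m G = 1%:M - u *m w ->
  char_poly P * (\det (G + u *m w))%:P = y * \det (1%:M + y *: map_mx polyC G).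
Proof.
move=> Gu PG; pose u' := map_mx polyC u; pose w' := map_mx polyC w.
rewrite -(@det_scalarD_group_inverse _ _ (map_mx polyC (1%:M - P)) _ u' w').
- rewrite -map_mxM -map_mxD det_map_mx map_mxB map_mx1 addrA -raddfD.
  by rewrite subrK.
- by rewrite -map_mxM mulmxBl mul1mx Pu subrr map_mx0.
- by rewrite -map_mxM Gu map_mx0.
- by rewrite -map_mxM wu map_mx1.
- by rewrite -!map_mxM PG map_mxB map_mx1.
Qed.

Lemma kemeny_group_inverse (G : 'M[algC]_n) :
  G *m u = 0 -> (1%:M - P) *m G = 1%:M - u *m w -> kemeny P = \tr G.
Proof.
move=> Gu PG; have [f1 df1] := deriv_det_scalar1D G 1.
have := char_poly_group_inverse Gu PG.
set c := \det _; set f := \det _ in f1 df1 * => charP.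
have c0 : c != 0.
  apply: contra_eq_neq charP => ->; rewrite polyC0 mulr0 eq_sym.
  rewrite mulf_neq0 ?polyXsubC_eq0 //.
  by apply: contra_eq_neq f1 => ->; rewrite horner0 eq_sym oner_neq0.
have charE : char_poly P = ('X - 1%:P) * (c^-1 *: f).
  by rewrite -scalerAr -charP mulrC mul_polyC scalerA mulVf ?scale1r.
have q1 : (c^-1 *: f).[1] = c^-1 by rewrite hornerZ f1 mulr1.
rewrite (kemeny_log_deriv charE) q1 ?invr_neq0 // derivZ hornerZ df1 mulrC.
by rewrite mulKf ?invr_neq0.
Qed.

Lemma kemeny_generalized_inverse (G : 'M[algC]_n) (x : 'cV[algC]_n) :
  (1%:M - P) *m G = 1%:M - x *m w -> kemeny P = \tr (G *m (1%:M - u *m w)).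
Proof.
move=> PG; have uwu : (1%:M - u *m w) *m u = 0.
  by rewrite mulmxBl mul1mx -mulmxA wu mulmx1 subrr.
have wuw : w *m (1%:M - u *m w) = 0.
  by rewrite mulmxBr mulmx1 mulmxA wu mul1mx subrr.
apply: kemeny_group_inverse; first by rewrite -mulmxA uwu mulmx0.
by rewrite mulmxA PG mulmxBl mul1mx -mulmxA wuw mulmx0 subr0.
Qed.

End GroupInverse.

Section Laplacian.

Variables (R : comNzRingType) (n : nat).
Implicit Types (A B G : 'M[R]_n) (x y : 'I_n).

Definition degree A : 'rV[R]_n := \row_i \sum_j A i j.

Definition laplacian A : 'M[R]_n := diag_mx (degree A) - A.

Definition edge_mx x y : 'M[R]_n := delta_mx x y + delta_mx y x.

Definition dipole x y : 'rV[R]_n := 'e_x - 'e_y.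

(* Column [j] of [G] is the potential of a unit current that enters at [j] and
   leaves through [tau]. *)
Definition green_function A (tau : 'cV[R]_n) G : Prop :=
  laplacian A *m G = 1%:M - tau *m const_mx 1.

Lemma degreeD A B : degree (A + B) = degree A + degree B.
Proof.
by apply/rowP => i; rewrite !mxE -big_split; apply: eq_bigr => j _; rewrite mxE.
Qed.

Lemma laplacianD A B : laplacian (A + B) = laplacian A + laplacian B.
Proof. by rewrite /laplacian degreeD raddfD opprD addrACA. Qed.

Lemma degree_edge_mx x y : degree (edge_mx x y) = 'e_x + 'e_y.
Proof.
have sum_delta a b i : \sum_j delta_mx a b i j = (i == a)%:R :> R.
  rewrite (bigD1 b) //= big1 => [|j /negPf jb]; rewrite mxE ?jb ?andbF //.
  by rewrite eqxx andbT addr0.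
by rewrite degreeD; congr (_ + _); apply/rowP => i; rewrite !mxE sum_delta.
Qed.

Lemma tr_dipole x y : (dipole x y)^T = delta_mx x 0 - delta_mx y 0.
Proof. by rewrite linearB /= !trmx_delta. Qed.

Lemma laplacian_edge_mx x y :
  laplacian (edge_mx x y) = (dipole x y)^T *m dipole x y.
Proof.
have diag_delta z : diag_mx 'e_z = delta_mx z z :> 'M[R]_n.
  apply/matrixP => i j; rewrite !mxE eqxx /=.
  by case: (i =P z) => [->|_]; rewrite ?mul0rn // eq_sym.
rewrite /laplacian degree_edge_mx [diag_mx _]raddfD /= !diag_delta opprD.
rewrite tr_dipole mulmxBl !mulmxBr !mul_delta_mx.
by rewrite opprB addrACA.
Qed.

Lemma mul_laplacianE A G i j :
  (laplacian A *m G) i j = \sum_k A i k * (G i j - G k j).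
Proof.
rewrite mulmxBl mul_diag_mx !mxE mulr_suml -sumrB.
by apply: eq_bigr => k _; rewrite mulrBr.
Qed.

End Laplacian.

Section Network.

Variables (F : fieldType) (n : nat).
Implicit Types (A G : 'M[F]_n) (d p : 'rV[F]_n).

Definition walk_mx A : 'M[F]_n := \matrix_(i, j) (A i j / degree A 0 i).

Definition volume d : F := \sum_i d 0 i.

(* The covariance form of the distribution [d / volume d], times [volume d]. *)
Definition cov_mx d : 'M[F]_n := diag_mx d - (volume d)^-1 *: (d^T *m d).

Lemma mxtrace_mul_cov d G :
  \tr (G *m cov_mx d) = \sum_i d 0 i * G i i
    - (\sum_i \sum_j d 0 i * G i j * d 0 j) / volume d.
Proof.
rewrite mulmxBr raddfB /= mul_mx_diag -scalemxAr mxtraceZ [_ / _]mulrC.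
congr (_ - _ * _); first by apply: eq_bigr => i _; rewrite mxE mulrC.
rewrite mulmxA; apply: eq_bigr => i _; rewrite mxE big_ord1 mxE mulr_suml.
by apply: eq_bigr => j _; rewrite mxE; ring.
Qed.

Lemma mxtrace_outer_cov d p :
  \tr (p^T *m p *m cov_mx d) = \sum_i d 0 i * p 0 i ^+ 2
    - (\sum_i d 0 i * p 0 i) ^+ 2 / volume d.
Proof.
rewrite mxtrace_mul_cov; congr (_ - _ / _).
  by apply: eq_bigr => i _; rewrite mxE big_ord1 mxE.
rewrite expr2 mulr_suml; apply: eq_bigr => i _.
rewrite mulr_sumr; apply: eq_bigr => j _.
by rewrite mxE big_ord1 mxE mulrA -!mulrA [p 0 j * _]mulrC.
Qed.

Lemma sherman_morrison A G (x : 'cV[F]_n) p (s := 1 + (p *m G *m x) 0 0) :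
    A *m G *m x = x -> s != 0 ->
  (A + x *m p) *m (G - s^-1 *: (G *m x *m (p *m G))) = A *m G.
Proof.
move=> AGx s0; have pGx : p *m G *m x = (s - 1)%:M.
  by rewrite [LHS]mx11_scalar addrC addKr.
set xpG := x *m p *m G.
have A_corr : A *m (G *m x *m (p *m G)) = xpG by rewrite !mulmxA AGx.
have xp_corr : x *m p *m (G *m x *m (p *m G)) = (s - 1) *: xpG.
  rewrite !mulmxA -[x *m p *m G]mulmxA -[x *m _ *m x]mulmxA pGx mul_mx_scalar.
  by rewrite -!scalemxAl.
rewrite mulmxDl !mulmxBr -!scalemxAr A_corr xp_corr -/xpG scalerA.
rewrite mulrBr mulVf // mulr1 scalerBl scale1r opprB.
by rewrite [xpG + _]addrC !subrK.
Qed.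

Lemma green_function_add_edge A G tau x y (p := row x G - row y G)
    (r := 1 + (p 0 x - p 0 y)) :
    green_function A tau G -> G^T = G -> r != 0 ->
  green_function (A + edge_mx F x y) tau (G - r^-1 *: (p^T *m p)).
Proof.
move=> LG symG r0; pose e := dipole F x y.
have pE : p = e *m G by rewrite /p !rowE -mulmxBl.
have Ge : G *m e^T = p^T by rewrite pE trmx_mul symG.
have rE : r = 1 + (e *m G *m e^T) 0 0.
  by rewrite /r -pE /e tr_dipole mulmxBr -!colE !mxE.
have const_e : const_mx 1 *m e^T = 0 :> 'M_1.
  by rewrite tr_dipole mulmxBr -!colE !col_const; exact: subrr.
rewrite /green_function laplacianD laplacian_edge_mx -LG -Ge pE rE.
apply: sherman_morrison; last by rewrite -rE.
by rewrite LG mulmxBl mul1mx -mulmxA const_e mulmx0 subr0.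
Qed.

End Network.

Lemma kemeny_walk (n : nat) (A G : 'M[algC]_n) (tau : 'cV[algC]_n) :
    (forall i, degree A 0 i != 0) -> volume (degree A) != 0 ->
    green_function A tau G ->
  kemeny (walk_mx A) = \tr (G *m cov_mx (degree A)).
Proof.
move dE: (degree A) => d d0 vol0 LG; pose one_cv : 'cV[algC]_n := const_mx 1.
pose dinv : 'rV_n := \row_i (d 0 i)^-1.
have dinvK : diag_mx dinv *m diag_mx d = 1%:M.
  apply/matrixP => i j; rewrite mul_diag_mx !mxE.
  by case: eqP => [->|_]; rewrite ?mulr0 // mulVf.
have d_one : diag_mx d *m one_cv = d^T.
  by apply/colP => i; rewrite mul_diag_mx !mxE mulr1.
have walkE : 1%:M - walk_mx A = diag_mx dinv *m laplacian A.
  rewrite /laplacian /walk_mx dE mulmxBr dinvK; congr (_ - _).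
  by apply/matrixP => i j; rewrite mul_diag_mx !mxE mulrC.
rewrite (@kemeny_generalized_inverse _ _ one_cv ((volume d)^-1 *: d) _ _
  (G *m diag_mx d) (volume d *: (diag_mx dinv *m tau))).
- by rewrite -mulmxA mulmxBr mulmx1 mulmxA d_one -scalemxAr.
- apply/colP => i; have := d0 i; rewrite -dE !mxE => di0.
  by under eq_bigr do rewrite !mxE mulr1; rewrite -mulr_suml divff.
- apply/matrixP => i j; rewrite !ord1 -scalemxAl !mxE.
  by under eq_bigr do rewrite mxE mulr1; rewrite mulVf.
- rewrite walkE mulmxA -[_ *m laplacian A *m G]mulmxA LG.
  rewrite mulmxBr mulmxBl mulmx1 dinvK.
  congr (_ - _); rewrite -scalemxAl -scalemxAr scalerA divff // scale1r.
  rewrite -!mulmxA; congr (_ *m (_ *m _)).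
  by apply/rowP => i; rewrite mul_mx_diag !mxE mul1r.
Qed.

Section SumsOverPath.

Variable V : nmodType.

Lemma sum_ord_minn (n x : nat) (f : nat -> V) : (x <= n)%N ->
  \sum_(i < n) f (minn i x) = \sum_(i < x) f i + f x *+ (n - x).
Proof.
move/subnKC; move: (n - x)%N => m <-; rewrite big_split_ord /=; congr (_ + _).
  by apply: eq_bigr => i _; rewrite (minn_idPl (ltnW (ltn_ord i))).
rewrite (eq_bigr (fun=> f x)) => [|i _]; last first.
  by rewrite (minn_idPr (leq_addr _ _)).
by rewrite sumr_const card_ord.
Qed.

Lemma sum_ord_subn (n x : nat) (f : nat -> V) : (x <= n)%N ->
  \sum_(i < n) f (i - x)%N = f 0 *+ x + \sum_(i < n - x) f i.
Proof.
move/subnKC; move: (n - x)%N => m <-; rewrite big_split_ord /=; congr (_ + _).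
  rewrite (eq_bigr (fun=> f 0)) => [|i _]; last first.
    by rewrite (eqP (ltnW (ltn_ord i))).
  by rewrite sumr_const card_ord.
by apply: eq_bigr => i _; rewrite addKn.
Qed.

End SumsOverPath.

Section PowerSums.

Variable F : numFieldType.

Lemma sum_ord_id (n : nat) :
  \sum_(i < n) (i%:R : F) = n%:R * (n%:R - 1) / 2%:R.
Proof.
elim: n => [|n IHn]; first by rewrite big_ord0 !mul0r.
by rewrite big_ord_recr /= IHn; field.
Qed.

Lemma sum_ord_sqr (n : nat) :
  \sum_(i < n) (i%:R ^+ 2 : F) = n%:R * (n%:R - 1) * (2%:R * n%:R - 1) / 6%:R.
Proof.
elim: n => [|n IHn]; first by rewrite big_ord0 !mul0r.
by rewrite big_ord_recr /= IHn; field.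
Qed.

End PowerSums.

Section Path.

Variables (R : comNzRingType) (n : nat) (s t : 'I_n).
Hypotheses (s0 : s = 0 :> nat) (tn : t.+1 = n :> nat).

Definition path_mx : 'M[R]_n :=
  \matrix_(i, j) (((j == i.+1 :> nat) || (i == j.+1 :> nat))%:R).

Definition minn_mx : 'M[R]_n := \matrix_(i, j) (minn i j)%:R.

Lemma sum_path_mx (i : 'I_n) (f : nat -> R) :
  \sum_j path_mx i j * f j = (i != t)%:R * f i.+1 + (i != s)%:R * f i.-1.
Proof.
have sum_if (c : bool) k : (c -> k < n)%N ->
    \sum_(j < n) (c && (j == k :> nat))%:R * f j = c%:R * f k.
  case: c => [/(_ isT) kn|_]; last first.
    by rewrite big1 ?mul0r // => j _; rewrite mul0r.
  rewrite (bigD1 (Ordinal kn)) //= eqxx big1 ?addr0 // => j.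
  by rewrite -val_eqE /= => /negPf ->; rewrite mul0r.
have [lt_succ lt_pred] : (i != t -> i.+1 < n)%N /\ (i != s -> i.-1 < n)%N.
  by rewrite -!val_eqE /=; have := ltn_ord i; split; lia.
rewrite -(sum_if _ _ lt_succ) -(sum_if _ _ lt_pred) -big_split /=.
apply: eq_bigr => j _; rewrite mxE -mulrDl -natrD; congr (_%:R * _).
by rewrite -!val_eqE /=; have := ltn_ord j; lia.
Qed.

Lemma degree_path_mx : degree path_mx = const_mx 2%:R - 'e_s - 'e_t.
Proof.
apply/rowP => i; rewrite !mxE.
under eq_bigr do rewrite -[path_mx _ _]mulr1.
rewrite (sum_path_mx i (fun=> 1)) !mulr1.
by case: (i == s); case: (i == t) => /=; ring.
Qed.

Lemma green_path_mx : green_function path_mx (delta_mx s 0) minn_mx.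
Proof.
apply/matrixP => i j; rewrite mul_laplacianE.
under eq_bigr do rewrite ![minn_mx _ _]mxE.
rewrite (sum_path_mx i (fun k => (minn i j)%:R - (minn k j)%:R)).
rewrite !mxE big_ord1 !mxE eqxx andbT mulr1.
rewrite -[i == j]val_eqE -[i == s]val_eqE /= s0.
have minn_succ x : (minn x.+1 j)%:R = (minn x j)%:R + (x < j)%:R :> R.
  by rewrite -natrD; congr _%:R; lia.
have -> : (i != t)%:R * ((minn i j)%:R - (minn i.+1 j)%:R) = - (i < j)%:R :> R.
  rewrite minn_succ opprD addNKr.
  case: eqVneq => [->|_]; last by rewrite mul1r.
  by rewrite mul0r ltnNge -ltnS tn ltn_ord oppr0.
case: (val i) => [|k] /=.
  by rewrite mul0r addr0; case: (val j) => [|?]; rewrite ?subrr ?oppr0 ?sub0r.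
rewrite minn_succ [_ + _ - _]addrAC subrr add0r mul1r subr0 addrC.
by case: (ltngtP k.+1 (val j)); rewrite ?subrr ?subr0.
Qed.

End Path.

Lemma subr_natr_ord_neq0 (R : numDomainType) (n : nat) (i : 'I_n) :
  n%:R - i%:R != 0 :> R.
Proof. by rewrite -natrB ?(ltnW (ltn_ord i)) // pnatr_eq0 subn_eq0 -ltnNge. Qed.

Section Barbell.

Variables (F : numFieldType) (n : nat) (s u v t : 'I_n).
Hypotheses (s0 : s = 0 :> nat) (tn : t.+1 = n :> nat) (uv : (u <= v)%N).

Let a : F := u%:R + 1.
Let b : F := n%:R - v%:R.
Let l : F := v%:R - u%:R.
Let m : F := n%:R + 1.

Definition barbell_mx : 'M[F]_n := path_mx F n + edge_mx F u s + edge_mx F t v.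

Definition minn_rv (x : nat) : 'rV[F]_n := \row_i (minn i x)%:R.

Definition subn_rv (x : nat) : 'rV[F]_n := \row_i (i - x)%:R.

Definition barbell_green : 'M[F]_n :=
  minn_mx F n - a^-1 *: ((minn_rv u)^T *m minn_rv u)
              - b^-1 *: ((subn_rv v)^T *m subn_rv v).

Lemma green_barbell : green_function barbell_mx (delta_mx s 0) barbell_green.
Proof.
have tr_minn : (minn_mx F n)^T = minn_mx F n.
  by apply/matrixP => i j; rewrite !mxE minnC.
have u_drop : row u (minn_mx F n) - row s (minn_mx F n) = minn_rv u.
  by apply/rowP => j; rewrite !mxE s0 min0n subr0 minnC.
have u_resistance : 1 + (minn_rv u 0 u - minn_rv u 0 s) = a.
  by rewrite !mxE s0 min0n subr0 minnn addrC.
have a_neq0 : a != 0 by rewrite /a natr1 pnatr_eq0.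
have := @green_function_add_edge _ _ _ _ _ u s (green_path_mx F s0 tn) tr_minn.
rewrite u_drop u_resistance => /(_ a_neq0); set G := _ - _ => green_G.
have tr_G : G^T = G.
  by rewrite linearB linearZ /= trmx_mul trmxK tr_minn.
have minn_t (j : 'I_n) : minn t j = j by apply/minn_idPr; rewrite -ltnS tn.
have v_drop : row t G - row v G = subn_rv v.
  apply/rowP => j; rewrite !mxE !big_ord1 !mxE !minn_t (minn_idPr uv).
  by rewrite opprB addrA subrK -natrB ?geq_minr //; congr _%:R; lia.
have v_resistance : 1 + (subn_rv v 0 t - subn_rv v 0 v) = b.
  rewrite !mxE subnn subr0 natrB; last by rewrite -ltnS tn.
  by rewrite addrA nat1r tn.
have := @green_function_add_edge _ _ _ _ _ t v green_G tr_G.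
by rewrite v_drop v_resistance; apply; exact: subr_natr_ord_neq0.
Qed.

Lemma degree_barbell : degree barbell_mx = const_mx 2%:R + 'e_u + 'e_v.
Proof.
rewrite 2!degreeD (degree_path_mx F s0 tn) !degree_edge_mx.
by apply/rowP => i; rewrite !mxE; ring.
Qed.

Lemma sum_degree_barbell (f : nat -> F) :
  \sum_i degree barbell_mx 0 i * f i = 2%:R * (\sum_(i < n) f i) + f u + f v.
Proof.
have sum_delta x : \sum_i 'e_x 0 i * f i = f x.
  rewrite (bigD1 x) //= mxE !eqxx mul1r big1 ?addr0 // => i /negPf xi.
  by rewrite mxE xi andbF mul0r.
under eq_bigr do rewrite degree_barbell mxE mulrDl mxE mulrDl.
by rewrite !big_split /= !sum_delta mulr_sumr; under eq_bigr do rewrite mxE.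
Qed.

Lemma volume_barbell : volume (degree barbell_mx) = 2%:R * (n%:R + 1).
Proof.
rewrite /volume; under eq_bigr do rewrite -[degree _ _ _]mulr1.
by rewrite (sum_degree_barbell (fun=> 1)) sumr_const card_ord; ring.
Qed.

Lemma sum_degree_minn (x : nat) : (x <= n)%N ->
  \sum_i degree barbell_mx 0 i * (minn i x)%:R =
  x%:R * (2%:R * n%:R - 1 - x%:R) + (minn u x)%:R + (minn v x)%:R.
Proof.
move=> xn; rewrite (sum_degree_barbell (fun i => (minn i x)%:R)).
rewrite (sum_ord_minn (fun i => i%:R)) // sum_ord_id.
by rewrite -[_ *+ (n - x)]mulr_natr natrB //; field.
Qed.

Let m_neq0 : m != 0.
Proof. by rewrite /m natr1 pnatr_eq0. Qed.

(* An edge of the path whose removal leaves degree sum [D] on one side contributes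
   [D (2 m - D) / (2 m)]; the first two terms come from the path edges inside the
   two cycles, the rest from those in between. *)
Lemma mxtrace_minn_mx_cov :
  \tr (minn_mx F n *m cov_mx (degree barbell_mx)) =
    a * (a - 1) * (1 - (2%:R * a - 1) / (3%:R * m))
  + b * (b - 1) * (1 - (2%:R * b - 1) / (3%:R * m))
  + l * (2%:R * a + l)
  - ((a + l) * (4%:R * (a + l) ^+ 2 - 1) - a * (4%:R * a ^+ 2 - 1))
    / (6%:R * m).
Proof.
pose d := degree barbell_mx.
have sum_row i : \sum_j d 0 i * minn_mx F n i j * d 0 j = d 0 i *
    (i%:R * (2%:R * n%:R - 1 - i%:R) + (minn i u)%:R + (minn i v)%:R).
  rewrite [minn i u]minnC [minn i v]minnC.
  rewrite -sum_degree_minn ?(ltnW (ltn_ord i)) //.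
  rewrite mulr_sumr; apply: eq_bigr => j _.
  by rewrite [minn_mx _ _ _ _]mxE minnC -mulrA [_%:R * _]mulrC.
rewrite mxtrace_mul_cov volume_barbell.
under eq_bigr do rewrite [minn_mx _ _ _ _]mxE minnn.
under [X in _ - X / _]eq_bigr do rewrite sum_row 2!mulrDr.
rewrite !big_split /= !sum_degree_minn ?(ltnW (ltn_ord _)) // !minnn.
rewrite (sum_degree_barbell (fun i => i%:R)).
rewrite (sum_degree_barbell (fun i => i%:R * (2%:R * n%:R - 1 - i%:R))).
under [X in _ - (2%:R * X + _ + _ + _ + _) / _]eq_bigr do
  rewrite mulrBr mulrC -expr2.
rewrite sumrB -mulr_sumr sum_ord_id sum_ord_sqr (minn_idPl uv) (minn_idPr uv).
by rewrite /a /b /l /m; field.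
Qed.

Lemma mxtrace_minn_rv_cov :
  \tr ((minn_rv u)^T *m minn_rv u *m cov_mx (degree barbell_mx)) =
  a * (a - 1) * ((2%:R * a - 1) / 3%:R - a * (a - 1) / (2%:R * m)).
Proof.
have un := ltnW (ltn_ord u); rewrite mxtrace_outer_cov volume_barbell.
under eq_bigr do rewrite [minn_rv _ _ _]mxE.
under [X in _ - X ^+ 2 / _]eq_bigr do rewrite [minn_rv _ _ _]mxE.
rewrite sum_degree_minn // minnn (minn_idPr uv).
rewrite (sum_degree_barbell (fun i => (minn i u)%:R ^+ 2)) minnn (minn_idPr uv).
rewrite (sum_ord_minn (fun i => i%:R ^+ 2)) // sum_ord_sqr.
rewrite -[_ *+ (n - u)]mulr_natr natrB //.
by rewrite /a /m; field.
Qed.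

Lemma mxtrace_subn_rv_cov :
  \tr ((subn_rv v)^T *m subn_rv v *m cov_mx (degree barbell_mx)) =
  b * (b - 1) * ((2%:R * b - 1) / 3%:R - b * (b - 1) / (2%:R * m)).
Proof.
have vn := ltnW (ltn_ord v); rewrite mxtrace_outer_cov volume_barbell.
under eq_bigr do rewrite [subn_rv _ _ _]mxE.
under [X in _ - X ^+ 2 / _]eq_bigr do rewrite [subn_rv _ _ _]mxE.
rewrite (sum_degree_barbell (fun i => (i - v)%:R)).
rewrite (sum_degree_barbell (fun i => (i - v)%:R ^+ 2)).
rewrite (sum_ord_subn (fun i => i%:R)) //.
rewrite (sum_ord_subn (fun i => i%:R ^+ 2)) //.
rewrite sum_ord_id sum_ord_sqr natrB // -/b -/m.
rewrite (eqP uv) subnn expr0n /= !mul0rn.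
by field.
Qed.

End Barbell.

Lemma kemeny_barbell (n : nat) (s u v t : 'I_n)
    (a : algC := u%:R + 1) (b : algC := n%:R - v%:R) (l : algC := v%:R - u%:R) :
    s = 0 :> nat -> t.+1 = n :> nat -> (u <= v)%N ->
  kemeny (walk_mx (barbell_mx algC s u v t)) = (a + b + l)^-1 *
  ( (a + 1) * (a - 1) / 6%:R * (a + 2%:R * (b + l))
  + (b + 1) * (b - 1) / 6%:R * (b + 2%:R * (a + l))
  + (a + b) * l ^+ 2 + l * (2%:R * l ^+ 2 + 1) / 6%:R + 2%:R * a * b * l).
Proof.
move=> s0 tn uv.
have mE : n%:R + 1 = a + b + l :> algC by rewrite /a /b /l; ring.
have m0 : a + b + l != 0 by rewrite -mE natr1 pnatr_eq0.
have a0 : a != 0 by rewrite /a natr1 pnatr_eq0.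
have b0 : b != 0 := subr_natr_ord_neq0 algC v.
rewrite (kemeny_walk _ _ (green_barbell algC s0 tn uv)).
- rewrite 2!mulmxBl -!scalemxAl 2!raddfB /= 2!mxtraceZ.
  rewrite (mxtrace_minn_mx_cov _ s0 tn uv) (mxtrace_minn_rv_cov _ s0 tn uv).
  rewrite (mxtrace_subn_rv_cov _ s0 tn uv) -/a -/b -/l mE.
  by field; rewrite m0 b0 a0.
- move=> i; rewrite (degree_barbell _ _ _ s0 tn) !mxE !eqxx /= -!natrD.
  by rewrite pnatr_eq0.
- by rewrite (volume_barbell _ _ _ s0 tn) mE mulf_neq0 ?pnatr_eq0.
Qed.

Lemma natb_orb_disjoint (p q : bool) :
  ~~ (p && q) -> (p || q) = (p + q)%N :> nat.
Proof. by case: p; case: q. Qed.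

Lemma natb_cb_edge (k a b i j : nat)
    (n := cb_n k a b) (u := a.-1) (v := (a + k - 2)%N) :
    (3 <= a)%N -> (3 <= b)%N -> (2 <= k)%N -> (i < n)%N -> (j < n)%N ->
  cb_edge k a b i j = (((j == i.+1) || (i == j.+1))
    + ((i == u) && (j == 0) + (i == 0) && (j == u))
    + ((i == n.-1) && (j == v) + (i == v) && (j == n.-1)))%N :> nat.
Proof.
move=> a3 b3 k2 lt_in lt_jn; rewrite /cb_edge -/n -/u -/v lt_in lt_jn !andbT.
have [lt1u ltuv ltvn] : [/\ 1 < u, u < v & v.+2 < n]%N.
  by rewrite /u /v /n /cb_n; split; lia.
clearbody n u v.
have -> : [&& i == v, j == n.-1 & (i < j)%N] = (i == v) && (j == n.-1) by lia.
have -> : [&& j == v, i == n.-1 & (j < i)%N] = (i == n.-1) && (j == v) by lia.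
rewrite orbA !natb_orb_disjoint; first by rewrite [(j == 0) && _]andbC; ring.
all: lia.
Qed.

Lemma cb_trans_barbell (a b k : nat) (s u v t : 'I_(cb_n k a b)) :
    (3 <= a)%N -> (3 <= b)%N -> (2 <= k)%N ->
    s = 0 :> nat -> u = a.-1 :> nat -> v = (a + k - 2)%N :> nat ->
    t = (cb_n k a b).-1 :> nat ->
  cb_trans k a b = walk_mx (barbell_mx algC s u v t).
Proof.
move=> a3 b3 k2 s0 uE vE tE.
have adjE i j : (cb_adj i j)%:R = barbell_mx algC s u v t i j.
  rewrite /cb_adj natb_cb_edge // !mxE -!natrD; congr _%:R.
  by rewrite -!val_eqE /= s0 uE vE tE.
apply/matrixP => i j; rewrite [LHS]mxE [RHS]mxE adjE; congr (_ / _).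
rewrite mxE /cb_deg -sum1_card natr_sum big_mkcond.
by apply: eq_bigr => x _; rewrite inE -adjE; case: cb_adj.
Qed.

Theorem theorem5p2 (a b k : nat) :
  (3 <= a)%N -> (3 <= b)%N -> (2 <= k)%N ->
  vertex_kemeny_cb k a b =
  ((a + b + k)%:R - 1)^-1 *
  ( (a%:R + 1) * (a%:R - 1) / 6%:R * (a%:R + 2%:R * (b%:R + k%:R - 1))
  + (b%:R + 1) * (b%:R - 1) / 6%:R * (b%:R + 2%:R * (a%:R + k%:R - 1))
  + (a%:R + b%:R) * (k%:R - 1) ^+ 2
  + (k%:R - 1) * (2%:R * k%:R ^+ 2 - 4%:R * k%:R + 3%:R) / 6%:R
  + 2%:R * a%:R * b%:R * (k%:R - 1) : algC).
Proof.
move=> a3 b3 k2; have nE : cb_n k a b = (a + b + k - 2)%N by [].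
have [lt_s lt_u lt_v lt_t] : [/\ 0 < cb_n k a b, a.-1 < cb_n k a b,
    a + k - 2 < cb_n k a b & (cb_n k a b).-1 < cb_n k a b]%N.
  by rewrite nE; split; lia.
rewrite /vertex_kemeny_cb (@cb_trans_barbell a b k (Ordinal lt_s) (Ordinal lt_u)
  (Ordinal lt_v) (Ordinal lt_t)) // kemeny_barbell //=; try lia.
have -> : (a.-1)%:R + 1 = a%:R :> algC by rewrite natr1 prednK //; lia.
have -> : (cb_n k a b)%:R - (a + k - 2)%:R = b%:R :> algC.
  by rewrite -natrB; [congr _%:R|]; lia.
have -> : (a + k - 2)%:R - (a.-1)%:R = k%:R - 1 :> algC.
  by rewrite -[1]/(1%:R) -!natrB; [congr _%:R| |]; lia.
by rewrite !natrD; congr (_^-1 * _); ring.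
Qed.
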